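(* Let $b,c\in\mathbb{R}$ and let $a\in\mathbb{R}$ be nonzero, and let $f:\mathbb{R}\to\mathbb{R}$ be the real quadratic polynomial function given by $f(x)=a\cdot x^2+b\cdot x+c$. Then there exist real numbers $h,k\in\mathbb{R}$ and complex numbers $r,s\in\mathbb{C}$ such that $f$ has the standard form $$f(x)=a\cdot(x-h)^2+k \quad\text{for all } x,$$ and the linear factored form $$f(x)=a\cdot(x-r)(x-s)\quad\text{for all } x,$$ where explicitly $$h=-\frac{b}{2a},\qquad k=\frac{4\cdot a\cdot c-b^2}{4a},\qquad r,s=-\frac{b}{2a}\pm\frac{\sqrt{b^2-4\cdot a\cdot c}}{2a},$$ with one of $r,s$ given by the sign $+$ and the other by the sign $-$.
   Context: For a real number $\Delta\ge 0$, $\sqrt{\Delta}$ is the nonnegative real square root; for $\Delta<0$, $\sqrt{\Delta}$ denotes $i\sqrt{-\Delta}\in\mathbb{C}$. The identities for $f$ are identities of quadratic polynomials; in the factored form the right-hand side is computed in $\mathbb{C}$, with $\mathbb{R}\subset\mathbb{C}$. *)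

(* Defs.v *)
From HB Require Import structures.
From mathcomp Require Import all_boot all_order all_algebra.
From mathcomp Require Import reals.
From mathcomp.real_closed Require Import complex.
Set Implicit Arguments.
Unset Strict Implicit.
Unset Printing Implicit Defensive.
Import Order.TTheory GRing.Theory Num.Theory.
Local Open Scope ring_scope.
Local Open Scope complex_scope.

(* [Num.sqrt] on [R] is 0 at negative arguments, hence the case split;
   'i is the imaginary unit [0 +i* 1] of R[i]. *)
Definition sqrt_real (R : realType) (D : R) : R[i] :=
  if 0 <= D then (Num.sqrt D)%:C else 'i * (Num.sqrt (- D))%:C.

(* Main.v *)
Require Import Defs.
From HB Require Import structures.
From mathcomp Require Import all_boot all_order all_algebra.
From mathcomp Require Import reals.
From mathcomp.real_closed Require Import complex.
From mathcomp Require Import ring.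
Set Implicit Arguments.
Unset Strict Implicit.
Unset Printing Implicit Defensive.
Import Order.TTheory GRing.Theory Num.Theory.
Local Open Scope ring_scope.
Local Open Scope complex_scope.

(** Both forms come from comparing coefficients.  Over any commutative ring,
    [a (X - h)^2 + k] has linear coefficient [- 2 a h] and constant
    coefficient [a h^2 + k], while [a (X - r) (X - s)] has [- a (r + s)] and
    [a r s] (Vieta).  So the polynomial identities reduce to field identities
    on the coefficients, and the identities of functions follow by evaluation.

    For the factored form, the roots are [h + d] and [h - d] with
    [d = sqrt(D) / (2 a)], so their sum is [2 h = - b / a] and their product is
    [h^2 - d^2 = (b^2 - D) / (4 a^2) = c / a].  The square root enters only
    through its square, so all that is needed is that [sqrt_real D] squares
    to [D] whatever the sign of [D] ([sqr_sqrt_real]). *)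

Lemma quadratic_vertex_form (A : comNzRingType) (a b c h k : A) :
    b = - (2 * a * h) -> c = a * h ^+ 2 + k ->
  a *: 'X^2 + b *: 'X + c%:P = a *: ('X - h%:P) ^+ 2 + k%:P.
Proof. by move=> -> ->; rewrite -!mul_polyC; ring. Qed.

Lemma quadratic_factored_form (A : comNzRingType) (a b c r s : A) :
    b = - (a * (r + s)) -> c = a * (r * s) ->
  a *: 'X^2 + b *: 'X + c%:P = a *: (('X - r%:P) * ('X - s%:P)).
Proof. by move=> -> ->; rewrite -!mul_polyC; ring. Qed.

(** For negative [D] the factor ['i ^+ 2 = -1] undoes the change of sign made
    under the real square root. *)
Lemma sqr_sqrt_real (R : realType) (D : R) : sqrt_real D ^+ 2 = D%:C.
Proof.
rewrite /sqrt_real; case: leP => [D_ge0 | D_lt0].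
  by rewrite -rmorphXn /= sqr_sqrtr.
rewrite exprMn -rmorphXn /= sqr_sqrtr ?oppr_ge0 ?ltW //.
by rewrite sqr_i mulN1r -rmorphN opprK.
Qed.

Theorem theorem2p1 (R : realType) (a b c : R) (f : R -> R)
    (a_neq0 : a != 0)
    (fE : forall x : R, f x = a * x ^+ 2 + b * x + c) :
  exists (h k : R) (r s : R[i]),
    (* standard form, as functions and as polynomials *)
    ((forall x : R, f x = a * (x - h) ^+ 2 + k) /\
     a *: 'X^2 + b *: 'X + c%:P = a *: ('X - h%:P) ^+ 2 + k%:P :> {poly R}) /\
    (* factored form over the complex numbers, likewise *)
    ((forall x : R, (f x)%:C = a%:C * (x%:C - r) * (x%:C - s)) /\
     a%:C *: 'X^2 + b%:C *: 'X + (c%:C)%:P =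
       a%:C *: (('X - r%:P) * ('X - s%:P)) :> {poly R[i]}) /\
    h = - (b / (2 * a)) /\
    k = (4 * a * c - b ^+ 2) / (4 * a) /\
    let D := b ^+ 2 - 4 * a * c in
    let p := (- (b / (2 * a)))%:C + sqrt_real D / (2 * a)%:C in
    let m := (- (b / (2 * a)))%:C - sqrt_real D / (2 * a)%:C in
    (r = p /\ s = m) \/ (r = m /\ s = p).
Proof.
have aC_neq0 : a%:C != 0 by rewrite fmorph_eq0.
set h := - (b / (2 * a)); set k := (4 * a * c - b ^+ 2) / (4 * a).
set d := sqrt_real (b ^+ 2 - 4 * a * c) / (2 * a)%:C.
have vertexE : a *: 'X^2 + b *: 'X + c%:P = a *: ('X - h%:P) ^+ 2 + k%:P.
  by apply: quadratic_vertex_form; rewrite /h /k; field; rewrite ?a_neq0.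
have hCE : h%:C = - (b%:C / (2 * a%:C)).
  by rewrite /h rmorphN fmorph_div rmorphM rmorph_nat.
have d2E : d ^+ 2 = (b%:C ^+ 2 - 4 * a%:C * c%:C) / (2 * a%:C) ^+ 2.
  rewrite /d expr_div_n sqr_sqrt_real.
  by rewrite rmorphB rmorphXn !rmorphM !rmorph_nat.
have factoredE : a%:C *: 'X^2 + b%:C *: 'X + (c%:C)%:P =
    a%:C *: (('X - (h%:C + d)%:P) * ('X - (h%:C - d)%:P)).
  apply: quadratic_factored_form; first by rewrite hCE; field; rewrite aC_neq0.
  rewrite [(_ + d) * _]mulrC -subr_sqr d2E hCE.
  by field; rewrite aC_neq0.
exists h, k, (h%:C + d), (h%:C - d); do !split=> //; last by left.
- move=> x; have := congr1 (horner^~ x) vertexE.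
  rewrite !(hornerD, hornerN, hornerZ, horner_exp, hornerX, hornerC).
  by rewrite fE => ->.
move=> x; have := congr1 (horner^~ x%:C) factoredE.
rewrite !(hornerD, hornerN, hornerZ, hornerM, horner_exp, hornerX, hornerC).
by move=> evalE; rewrite -[RHS]mulrA -evalE fE !rmorphD rmorphM rmorphXn rmorphM.
Qed.
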